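(* There exist constants $C,C'>0$ such that for every integer $N\ge2$ there exist polynomials $p_\varepsilon\in\mathcal{P}_N$ ($\varepsilon>0$) with $\|p_\varepsilon\|_N=1$ such that, for all $\varepsilon>0$ small enough, $$D_N(p_\varepsilon)\ge\frac{C}{N}\,\varepsilon^2,\qquad S_N(p_\varepsilon)-S_N(1)\le\frac{C'}{N^2}\,\varepsilon^4 .$$
   Context: Let $\mathcal{P}_N$ be the space of complex polynomials in one variable of degree at most $N$. Let $m$ be the probability measure on $\mathbb{C}$ given by $dm(z)=\frac{dx\,dy}{\pi(1+|z|^2)^2}$, $z=x+iy$. The norm on $\mathcal{P}_N$ is $\|P\|_N^2=(N+1)\int_{\mathbb{C}}\frac{|P(z)|^2}{(1+|z|^2)^N}\,dm(z)$. The Wehrl entropy of $P\in\mathcal{P}_N\setminus\{0\}$ is $$S_N(P)=-(N+1)\int_{\mathbb{C}}\frac{|\hat P(z)|^2}{(1+|z|^2)^N}\log\Big(\frac{|\hat P(z)|^2}{(1+|z|^2)^N}\Big)\,dm(z),\qquad \hat P=P/\|P\|_N,$$ with $0\log0=0$. For $a\in\mathbb{C}$ the normalized reproducing kernel is $\kappa_{N,a}(z)=\frac{(1+z\bar a)^N}{(1+|a|^2)^{N/2}}$, and for $\|P\|_N=1$, $D_N(P)=\inf\{\|P-e^{i\theta}\kappa_{N,a}\|_N:\ a\in\mathbb{C},\ \theta\in[0,2\pi]\}$. The threshold in ''$\varepsilon$ small enough'' may depend on $N$; $C,C'$ do not. *)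

(* Defs.v *)
From mathcomp Require Import all_boot all_order all_algebra.
From mathcomp Require Import complex.
From mathcomp Require Import all_classical all_reals all_analysis.

Set Implicit Arguments.
Unset Strict Implicit.
Unset Printing Implicit Defensive.

Import Order.TTheory GRing.Theory Num.Theory.

Local Open Scope classical_set_scope.
Local Open Scope complex_scope.
Local Open Scope ring_scope.

Definition polys_le (R : realType) (N : nat) : set {poly R[i]} :=
  [set P | (size P <= N.+1)%N].

(* Real-valued square modulus: the norm `|z| of R[i] takes values in R[i]. *)
Definition sqmod (R : realType) (z : R[i]) : R := Normc.normc z ^+ 2.

(* Integral of f : C -> R against dm(z) = dx dy / (pi (1 + |z|^2)^2),
   with C identified with R * R through z = x + i y.
   [Rintegral] yields 0 when the integral is infinite, but the functions f used
   below are bounded on C whenever deg P <= N, and m is finite. *)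
Definition integral_m (R : realType) (f : R[i] -> R) : R :=
  \int[(@lebesgue_measure R \x @lebesgue_measure R)%E]_xy
    (let z := xy.1 +i* xy.2 in f z / (pi * (1 + sqmod z) ^+ 2)).

Definition husimi (R : realType) (N : nat) (P : {poly R[i]}) (z : R[i]) : R :=
  sqmod P.[z] / (1 + sqmod z) ^+ N.

Definition normN (R : realType) (N : nat) (P : {poly R[i]}) : R :=
  Num.sqrt (N.+1%:R * integral_m (husimi N P)).

Definition normalize (R : realType) (N : nat) (P : {poly R[i]}) : {poly R[i]} :=
  ((normN N P)^-1)%:C *: P.

(* The convention 0 log 0 = 0 holds because of the factor 0. *)
Definition wehrl (R : realType) (N : nat) (P : {poly R[i]}) : R :=
  - (N.+1%:R * integral_m (fun z =>
       husimi N (normalize N P) z * ln (husimi N (normalize N P) z))).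

Definition kernelN (R : realType) (N : nat) (a : R[i]) : {poly R[i]} :=
  (((1 + sqmod a) `^ (N%:R / 2))^-1)%:C *: (1 + (a^*)%C *: 'X) ^+ N.

Definition expi (R : realType) (t : R) : R[i] := cos t +i* sin t.

Definition distN (R : realType) (N : nat) (P : {poly R[i]}) : R :=
  inf [set r : R | exists (a : R[i]) (t : R),
         0 <= t <= 2 * pi /\ r = normN N (P - expi t *: kernelN N a)].

(* Main.v *)
Require Import Defs.
From mathcomp Require Import all_boot all_order all_algebra.
From mathcomp Require Import cyclic separable cyclotomic.
From mathcomp Require Import complex zify ring lra.
From mathcomp Require Import all_classical all_reals all_analysis.
From mathcomp Require Import measurable_realfun.

Set Implicit Arguments.
Unset Strict Implicit.
Unset Printing Implicit Defensive.

Import Order.TTheory GRing.Theory Num.Theory.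
Import numFieldNormedType.Exports.
Local Open Scope classical_set_scope.
Local Open Scope ring_scope.

(* With d = eps^2 / N and c = binomial(N, 2), take p = b (1 + d sqrt(c) z^2),
   b = (1 + d^2)^(-1/2): a perturbation of the constant 1 of relative size d,
   orthogonal to the tangent space of the kernels at 1.

   Entropy. Write u and v for the Husimi densities of 1 and p. Gibbs' inequality
   v ln v >= v ln u + v - u reduces the deficit to
   N (N + 1) int (v - u) ln (1 + |z|^2) dm. The term of v - u linear in d is
   odd under z -> i z, and the quadratic one is O(d^2) because
   ln (1 + s) <= 2 s / sqrt (1 + s) turns it into a Beta integral.

   Distance. Averaging |P|^2 over the rotations by roots of unity gives
   |c_k|^2 <= binomial(N, k) ||P||^2 for the coefficients c_k of P. If
   P = p - e^(it) kappa_a has norm eta, the cases k = 0, 1, 2 say successively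
   that kappa_a has a large constant term, that N |a|^2 = O(eta^2), and
   that b d <= eta + O(N |a|^2), whence eta >= d / 4.

   Integrals. Rotations are products of three shears, so Tonelli gives their
   invariance; radial integrals are computed through x = y t in place of polar
   coordinates. *)

(** * Arithmetic of the squared modulus *)

Lemma sqmodE (R : realType) (z : R[i]) :
  sqmod z = complex.Re z ^+ 2 + complex.Im z ^+ 2.
Proof.
by case: z => x y; rewrite /sqmod/= sqr_sqrtr// addr_ge0// sqr_ge0.
Qed.

Lemma sqmod_ge0 (R : realType) (z : R[i]) : 0 <= sqmod z.
Proof. exact: sqr_ge0. Qed.

Lemma sqmodM (R : realType) (z w : R[i]) : sqmod (z * w) = sqmod z * sqmod w.
Proof. by rewrite /sqmod Normc.normcM exprMn. Qed.

Lemma sqmodX (R : realType) (z : R[i]) n : sqmod (z ^+ n) = sqmod z ^+ n.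
Proof.
elim: n => [|n ih]; last by rewrite !exprS sqmodM ih.
by rewrite !expr0 sqmodE/= expr1n expr0n/= addr0.
Qed.

(** * Affine changes of variable, shears and rotations of the plane *)

Section plane_integral.
Context {R : realType}.
Local Notation mu := (@lebesgue_measure R).
Local Notation mu2 := (mu \x mu)%E.
Lemma measurable_shear1 (t : R) :
  measurable_fun setT (fun p : R * R => (p.1 + t * p.2, p.2)).
Proof.
apply: measurable_fun_pair => //.
by apply: measurable_funD => //; exact: measurable_funM.
Qed.

Lemma measurable_shear2 (t : R) :
  measurable_fun setT (fun p : R * R => (p.1, p.2 + t * p.1)).
Proof.
apply: measurable_fun_pair => //.
by apply: measurable_funD => //; exact: measurable_funM.
Qed.

Local Open Scope ereal_scope.

(** The pushforward of Lebesgue measure under [a * x + b], scaled by [|a|], gives every half-open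
    interval its length, so by uniqueness it is Lebesgue measure. *)
Lemma ge0_integral_affine (a b : R) (f : R -> \bar R) : (a != 0)%R ->
  measurable_fun setT f -> (forall x, 0 <= f x) ->
  \int[mu]_x f x = (`|a|%R)%:E * \int[mu]_x f (a * x + b)%R.
Proof.
move=> a0 mf f0.
pose phi := (fun x => a * x + b)%R : measurableTypeR R -> measurableTypeR R.
have mphi : measurable_fun setT phi.
  apply: measurable_funD => //; exact: measurable_funM.
pose m1 : {measure set (measurableTypeR R) -> \bar R} :=
  measure_function_pushforward__canonical__measure_function_Measure mu mphi.
pose m2 : {measure set (measurableTypeR R) -> \bar R} :=
  mscale (NngNum (normr_ge0 a)) m1.
have phiE : forall A, measurable A -> mu A = m2 A.
  apply: lebesgue_measure_unique => //= _ [[c d]] _ <-.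
  rewrite /m2 /mscale/= /pushforward lebesgue_measure_itv/= lte_fin.
  case: (ltrgtP a 0%R) a0 => // a0 _.
  (* A negative slope reverses the interval: the preimage is closed on the left and open on the
     right. *)
  - have -> : phi @^-1` `]c, d] = `[((d - b) / a)%R, ((c - b) / a)%R[%classic.
      apply/seteqP; split=> x /=; rewrite !in_itv/= /phi => /andP[];
        rewrite ler_ndivrMr// ltr_ndivlMr// => h1 h2; apply/andP; split; lra.
    rewrite lebesgue_measure_itv/= lte_fin ltr_nM2r ?invr_lt0// ltrD2r.
    case: ifPn => _; last by rewrite mule0.
    rewrite -!EFinB -EFinM ltr0_norm//; congr EFin; field; lra.
  - have -> : phi @^-1` `]c, d] = `]((c - b) / a)%R, ((d - b) / a)%R]%classic.
      apply/seteqP; split=> x /=; rewrite !in_itv/= /phi => /andP[];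
        rewrite ler_pdivlMr// ltr_pdivrMr// => h1 h2; apply/andP; split; lra.
    rewrite lebesgue_measure_itv/= lte_fin ltr_pM2r ?invr_gt0// ltrD2r.
    case: ifPn => _; last by rewrite mule0.
    rewrite -!EFinB -EFinM gtr0_norm//; congr EFin; field; lra.
rewrite (eq_measure_integral m2); last by move=> A mA _; exact: phiE.
rewrite ge0_integral_mscale//=.
by rewrite ge0_integral_pushforward.
Qed.

(** By Tonelli, the shear only translates each horizontal slice, and translations preserve the
    integral. *)
Lemma ge0_integral_shear1 (t : R) (f : R * R -> \bar R) :
  measurable_fun setT f -> (forall x, 0 <= f x) ->
  \int[mu2]_p f (p.1 + t * p.2, p.2)%R = \int[mu2]_p f p.
Proof.
move=> mf f0.
have mg : measurable_fun [set: R * R] (fun p => f (p.1 + t * p.2, p.2)%R).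
  exact: measurableT_comp mf (measurable_shear1 t).
rewrite (fubini_tonelli2 (m1 := mu) (m2 := mu) _ mg)//.
rewrite (fubini_tonelli2 (m1 := mu) (m2 := mu) _ mf)//.
apply: eq_integral => y _; rewrite /fubini_G/=.
have mfy : measurable_fun [set: R] (fun x => f (x, y)).
  exact: measurableT_comp.
rewrite [RHS](ge0_integral_affine (t * y) (oner_neq0 _) mfy (fun=> f0 _)).
by rewrite normr1 mul1e; under [RHS]eq_integral do rewrite mul1r.
Qed.

Lemma ge0_integral_shear2 (t : R) (f : R * R -> \bar R) :
  measurable_fun setT f -> (forall x, 0 <= f x) ->
  \int[mu2]_p f (p.1, p.2 + t * p.1)%R = \int[mu2]_p f p.
Proof.
move=> mf f0.
have mg : measurable_fun [set: R * R] (fun p => f (p.1, p.2 + t * p.1)%R).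
  exact: measurableT_comp mf (measurable_shear2 t).
rewrite (fubini_tonelli1 (m1 := mu) (m2 := mu) _ mg)//.
rewrite (fubini_tonelli1 (m1 := mu) (m2 := mu) _ mf)//.
apply: eq_integral => y _; rewrite /fubini_F/=.
have mfy : measurable_fun [set: R] (fun x => f (y, x)).
  exact: measurableT_comp.
rewrite [RHS](ge0_integral_affine (t * y) (oner_neq0 _) mfy (fun=> f0 _)).
by rewrite normr1 mul1e; under [RHS]eq_integral do rewrite mul1r.
Qed.


(* For c <> -1, the rotation of cosine c and sine s is the composite of three
   shears, of slopes -s/(1+c), s and -s/(1+c). *)
Lemma ge0_integral_rotation (c s : R) (f : R * R -> \bar R) :
  (c ^+ 2 + s ^+ 2 = 1)%R -> (1 + c != 0)%R ->
  measurable_fun setT f -> (forall x, 0 <= f x) ->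
  \int[mu2]_p f (c * p.1 - s * p.2, s * p.1 + c * p.2)%R = \int[mu2]_p f p.
Proof.
move=> cs c1 mf f0; pose t := (- (s / (1 + c)))%R.
have tc : (t * (1 + c) = - s)%R by rewrite /t mulNr divfK.
have ts : (t * s = c - 1)%R.
  apply: (mulIf c1); rewrite mulrAC tc.
  have -> : ((c - 1) * (1 + c) = c ^+ 2 - 1)%R by ring.
  by rewrite -cs; ring.
pose f1 p := f (p.1 + t * p.2, p.2)%R.
pose f2 p := f1 (p.1, p.2 + s * p.1)%R.
have mf1 : measurable_fun [set: R * R] f1.
  exact: measurableT_comp mf (measurable_shear1 t).
have mf2 : measurable_fun [set: R * R] f2.
  exact: measurableT_comp mf1 (measurable_shear2 s).
rewrite -[RHS](ge0_integral_shear1 t mf f0).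
rewrite -[RHS](ge0_integral_shear2 s mf1 (fun=> f0 _)).
rewrite -[RHS](ge0_integral_shear1 t mf2 (fun=> f0 _)).
apply: eq_integral => -[x y] _; rewrite /f2 /f1/=; congr (f (_, _)).
  have -> : (x + t * y + t * (y + s * (x + t * y)) =
    x * (1 + t * s) + t * y * (2 + t * s))%R by ring.
  have -> : (t * y * (2 + t * s) = t * (1 + c) * y)%R by rewrite ts; ring.
  by rewrite ts tc; ring.
have -> : (y + s * (x + t * y) = s * x + y * (1 + t * s))%R by ring.
by rewrite ts; ring.
Qed.

(** The nonnegative case applies to the positive and negative parts separately. *)
Lemma integral_rotation (c s : R) (f : R * R -> \bar R) :
  (c ^+ 2 + s ^+ 2 = 1)%R -> (1 + c != 0)%R -> measurable_fun setT f ->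
  \int[mu2]_p f (c * p.1 - s * p.2, s * p.1 + c * p.2)%R = \int[mu2]_p f p.
Proof.
move=> cs c1 mf; rewrite integralE [RHS]integralE.
have mp := measurable_funepos mf; have mn := measurable_funeneg mf.
have h1 := ge0_integral_rotation cs c1 mp (funepos_ge0 f).
have h2 := ge0_integral_rotation cs c1 mn (funeneg_ge0 f).
rewrite -h1 -h2; congr (_ - _); apply: eq_integral => p _.
  by rewrite !funeposE.
by rewrite !funenegE.
Qed.

End plane_integral.

(** * Rotation invariance of the measure m *)

Section integral_m.
Context {R : realType}.
Local Notation mu2 := (@lebesgue_measure R \x @lebesgue_measure R)%E.

Definition density (f : R[i] -> R) (p : R * R) : R :=
  let z := (p.1 +i* p.2)%C in f z / (pi * (1 + sqmod z) ^+ 2).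

Lemma measurable_sqmod :
  measurable_fun setT (fun p : R * R => sqmod (p.1 +i* p.2)%C).
Proof.
under eq_fun do rewrite sqmodE/=.
by apply: measurable_funD; exact: measurable_funX.
Qed.

Lemma measurable_density (f : R[i] -> R) :
  measurable_fun setT (fun p : R * R => f (p.1 +i* p.2)%C) ->
  measurable_fun setT (density f).
Proof.
move=> mf; apply: measurable_funM => //.
have s0 (p : R * R) : 0 <= pi * (1 + sqmod (p.1 +i* p.2)%C) ^+ 2.
  by rewrite mulr_ge0 ?pi_ge0// exprn_ge0// addr_ge0// sqmod_ge0.
(* The inverse is rewritten as a real power, whose measurability is available. *)
under eq_fun do rewrite -powR_inv1//.
apply: (measurableT_comp (measurable_powR _)).
apply: measurable_funM; first by [].
apply: measurable_funX.
by apply: measurable_funD => //; exact: measurable_sqmod.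
Qed.

(** The weight of m depends on [|z|] only. On the unit circle, [u != -1] amounts to [1 + c != 0],
    under which the rotation splits into shears. *)
Lemma integral_m_rotation (u : R[i]) (f : R[i] -> R) :
  sqmod u = 1 -> u != -1 ->
  measurable_fun setT (fun p : R * R => f (p.1 +i* p.2)%C) ->
  integral_m (fun z => f (u * z)) = integral_m f.
Proof.
case: u => c s; rewrite sqmodE/= => cs c1 mf; rewrite /integral_m/Rintegral.
have c1' : 1 + c != 0.
  apply: contra c1 => /eqP c1; have ? : c = -1 by lra.
  have s0 : s ^+ 2 = 0 by subst c; lra.
  move/eqP: s0; rewrite sqrf_eq0 => /eqP s0.
  by rewrite eq_complex/= s0 oppr0 eqxx andbT; apply/eqP.
have /measurable_EFinP mg := measurable_density mf.
congr fine; rewrite -[RHS](integral_rotation cs c1' mg).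
apply: eq_integral => -[x y] _ /=; rewrite /density/=.
have -> : ((c +i* s) * (x +i* y) = (c * x - s * y) +i* (s * x + c * y))%C.
  by rewrite [LHS]/=; congr Complex; rewrite addrC.
congr (EFin (_ / (pi * (1 + _) ^+ 2))); rewrite !sqmodE/=.
transitivity ((c ^+ 2 + s ^+ 2) * (x ^+ 2 + y ^+ 2)); last by ring.
by rewrite cs mul1r.
Qed.

End integral_m.

(** * A substitute for polar coordinates *)

Section radial.
Context {R : realType}.
Local Notation mu := (@lebesgue_measure R).
Local Notation mu2 := (mu \x mu)%E.

(** For fixed [y != 0] the substitution [x = y t] has Jacobian [|y|]; the line [y = 0] is null.
    Tonelli then moves the slope [t] outside. *)
Lemma ge0_integral_polar (f : R -> R) : measurable_fun setT f ->
  (forall r, 0 <= f r) ->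
  (\int[mu2]_p (f (p.1 ^+ 2 + p.2 ^+ 2))%:E =
   \int[mu]_t \int[mu]_y (`|y| * f (y ^+ 2 * (1 + t ^+ 2)))%:E)%E.
Proof.
move=> mf f0.
have m1 : measurable_fun [set: R * R]
    (fun p : R * R => (f (p.1 ^+ 2 + p.2 ^+ 2))%:E).
  apply/measurable_EFinP; apply: (measurableT_comp mf).
  by apply: measurable_funD; exact: measurable_funX.
have m2 : measurable_fun [set: R * R]
    (fun p : R * R => (`|p.2| * f (p.2 ^+ 2 * (1 + p.1 ^+ 2)))%:E).
  apply/measurable_EFinP; apply: measurable_funM.
    exact: measurableT_comp.
  apply: (measurableT_comp mf); apply: measurable_funM.
    exact: measurable_funX.
  by apply: measurable_funD => //; exact: measurable_funX.
have f1 (p : R * R) : (0 <= (f (p.1 ^+ 2 + p.2 ^+ 2))%:E)%E by rewrite lee_fin.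
have f2 (p : R * R) : (0 <= (`|p.2| * f (p.2 ^+ 2 * (1 + p.1 ^+ 2)))%:E)%E.
  by rewrite lee_fin mulr_ge0.
rewrite (fubini_tonelli2 (m1 := mu) (m2 := mu) _ m1)//.
rewrite [RHS](fubini_tonelli (m1 := mu) (m2 := mu) _ m2)//.
apply: ae_eq_integral => //.
- exact: (measurable_fun_fubini_tonelli_G (m1 := mu) _ m1 f1).
- exact: (measurable_fun_fubini_tonelli_G (m1 := mu) _ m2 f2).
exists [set 0]; split => //; first exact: lebesgue_measure_set1.
move=> y /= /not_implyP[_ h]; apply: contrapT => /eqP y0; apply: h.
rewrite /fubini_G/=.
have my : measurable_fun [set: R] (fun x : R => (f (x ^+ 2 + y ^+ 2))%:E).
  apply/measurable_EFinP; apply: (measurableT_comp mf).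
  by apply: measurable_funD => //; exact: measurable_funX.
rewrite (ge0_integral_affine 0 y0 my (fun=> f1 (_, _))).
rewrite -ge0_integralZl//.
- apply: eq_integral => x _; rewrite -EFinM; congr (EFin (_ * f _)); ring.
- apply/measurable_EFinP; apply: (measurableT_comp mf).
  apply: measurable_funD => //; apply: measurable_funX.
  by apply: measurable_funD => //; exact: measurable_funM.
by move=> x _; exact: (f1 (_, _)).
Qed.

End radial.

(** * Evaluation of radial integrals *)

Section radial.
Context {R : realType}.
Local Notation mu := (@lebesgue_measure R).
Local Notation mu2 := (mu \x mu)%E.

(** At [r = |z|^2] this is the radial variable on [[0, 1]] in which the integrands become
    polynomials; its derivative along [r = k y^2] is [- k y rho^3]. *)
Definition rho (r : R) : R := (Num.sqrt (1 + r))^-1.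

Lemma rho_gt0 (r : R) : 0 <= r -> 0 < rho r.
Proof. by move=> r0; rewrite invr_gt0 sqrtr_gt0; lra. Qed.

Lemma rho_le1 (r : R) : 0 <= r -> rho r <= 1.
Proof.
move=> r0; rewrite invf_le1 ?sqrtr_gt0; last lra.
by rewrite -[leLHS]sqrtr1 ler_sqrt; lra.
Qed.

Lemma rho_sqr (r : R) : 0 <= r -> rho r ^+ 2 = (1 + r)^-1.
Proof. by move=> r0; rewrite exprVn sqr_sqrtr//; lra. Qed.

Lemma is_derive_rho (k y : R) : 0 <= k ->
  is_derive y 1 (fun y => rho (k * y ^+ 2)) (- (k * y * rho (k * y ^+ 2) ^+ 3)).
Proof.
move=> k0; have k1 : 0 < 1 + k * y ^+ 2.
  by rewrite ltr_pwDl// mulr_ge0// sqr_ge0.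
have d1 : is_derive y 1 (fun y => 1 + k * y ^+ 2) (2 * k * y).
  by apply: is_derive_eq; rewrite /GRing.scale/=; ring.
have d2 := is_derive1_comp (f := Num.sqrt)
    (g := fun y => 1 + k * y ^+ 2) (is_derive1_sqrt k1) d1.
have s0 : Num.sqrt (1 + k * y ^+ 2) != 0 by rewrite gt_eqF// sqrtr_gt0.
have d3 := is_deriveV (f := Num.sqrt \o (fun y => 1 + k * y ^+ 2)) s0 d2.
refine (is_derive_eq d3 _).
rewrite /rho /GRing.scale/=.
by field.
Qed.

(** The absolute value avoids the singularity of [rho] at -1 and gives a function continuous on the
    whole line, as [ge0_integral_polar] needs measurability there. *)
Lemma continuous_rho_norm : continuous (fun r : R => rho `|r|).
Proof.
move=> r; apply: cvgV; first by rewrite gt_eqF// sqrtr_gt0 ltr_pwDl.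
apply: (continuous_comp (f := fun r : R => 1 + `|r|) (g := Num.sqrt)).
  by apply: cvgD; [exact: cvg_cst|exact: norm_continuous].
exact: sqrt_continuous.
Qed.

Lemma cvg_rho (k : R) : 0 < k -> rho (k * y ^+ 2 : R) @[y --> +oo] --> 0.
Proof.
move=> k0; apply/(gtr0_cvgV0 (f := fun y : R => Num.sqrt (1 + k * y ^+ 2))).
  near=> y; rewrite sqrtr_gt0 ltr_pwDl// mulr_ge0 ?sqr_ge0//; exact: ltW.
apply/cvgryPge => A; near=> y.
have y1 : 1 <= y by near: y; apply: nbhs_pinfty_ge; exact: num_real.
have y2 : A ^+ 2 / k <= y by near: y; apply: nbhs_pinfty_ge; exact: num_real.
rewrite (le_trans (ler_norm A))// -sqrtr_sqr ler_sqrt; last first.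
  by rewrite addr_ge0// mulr_ge0 ?sqr_ge0// ltW.
rewrite ler_pdivrMr// in y2.
have : y * k <= k * y ^+ 2 by rewrite mulrC ler_pM2l// expr2 ler_peMl//; lra.
lra.
Unshelve. all: by end_near. Qed.

Lemma continuous_weight (G : {poly R}) (u : R -> R) : continuous u ->
  continuous (fun y : R => G.[u y] * u y ^+ 3).
Proof.
move=> cu; under eq_fun do rewrite -hornerXn -hornerM.
by move=> y; exact: (continuous_comp (cu y) (@continuous_horner _ _ (u y))).
Qed.

(** An antiderivative is [- G(rho (k y^2)) / k], and [rho (k y^2)] decreases from 1 at [y = 0] to 0
    at infinity. *)
Lemma integral0y_rho (G : {poly R}) (k : R) : 0 < k ->
  (forall v, 0 <= v <= 1 -> 0 <= G^`().[v]) ->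
  (\int[mu]_(y in `[0%R, +oo[)
     (y * (G^`().[rho (k * y ^+ 2)] * rho (k * y ^+ 2) ^+ 3))%:E =
   (k^-1 * (G.[1] - G.[0]))%:E)%E.
Proof.
move=> k0 G0; have k0' := ltW k0.
have ky (y : R) : 0 <= k * y ^+ 2 by rewrite mulr_ge0 ?sqr_ge0.
pose F y := - (k^-1 * G.[rho (k * y ^+ 2)]).
have crho : continuous (fun y : R => rho (k * y ^+ 2)).
  move=> y; apply: differentiable_continuous; apply/derivable1_diffP.
  by case: (is_derive_rho y k0').
have dF (y : R) : is_derive y 1 F
    (y * (G^`().[rho (k * y ^+ 2)] * rho (k * y ^+ 2) ^+ 3)).
  have d1 := is_derive1_comp (f := horner G)
    (g := fun y => rho (k * y ^+ 2)) (is_derive_poly G _) (is_derive_rho y k0').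
  refine (is_derive_eq (is_deriveN (is_deriveZ k^-1 d1)) _).
  by rewrite /GRing.scale/=; field; rewrite gt_eqF.
have cF : continuous F.
  move=> y; apply: differentiable_continuous; apply/derivable1_diffP.
  by case: (dF y).
rewrite (@ge0_continuous_FTC2y _ _ F 0 (- (k^-1 * G.[0]))).
- rewrite -EFinB; congr EFin.
  rewrite /F expr0n mulr0 /rho addr0 sqrtr1 invr1; ring.
- move=> y y0; rewrite !mulr_ge0 ?exprn_ge0 ?(ltW (rho_gt0 _))//.
  by rewrite G0// (ltW (rho_gt0 _))//= rho_le1.
- apply: continuous_subspaceT => y.
  apply: cvgM; first exact: cvg_id.
  exact: (continuous_weight crho).
- apply: cvgN; apply: cvgZl_tmp.
  exact: (cvg_comp _ _ (cvg_rho k0) (@continuous_horner _ G 0)).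
- by move=> y _; case: (dF y).
- by apply: cvg_at_right_filter; exact: cF.
- by move=> y _; rewrite derive1E; case: (dF y).
Qed.

Lemma measurable_rho_norm : measurable_fun setT (fun r : R => rho `|r|).
Proof. exact: continuous_measurable_fun continuous_rho_norm. Qed.

(** Along slope [t] the inner integral is twice [(G(1) - G(0)) / (1 + t^2)], and [1 / (1 + t^2)] has
    integral [pi] over the line. *)
Lemma ge0_integral_radial (G : {poly R}) :
  (forall v, 0 <= v <= 1 -> 0 <= G^`().[v]) ->
  (\int[mu2]_p (G^`().[rho (p.1 ^+ 2 + p.2 ^+ 2)] *
                rho (p.1 ^+ 2 + p.2 ^+ 2) ^+ 3)%:E =
   (2 * pi * (G.[1] - G.[0]))%:E)%E.
Proof.
move=> G0; pose g (r : R) := G^`().[rho `|r|] * rho `|r| ^+ 3.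
have cg : continuous g := continuous_weight continuous_rho_norm.
have g0 r : 0 <= g r.
  apply: mulr_ge0; last by rewrite exprn_ge0// ltW// rho_gt0.
  apply: G0.
  by rewrite (ltW (rho_gt0 _))//= rho_le1.
(* The sign is read off the one-dimensional formula at [k = 1], whose integrand is nonnegative. *)
have GG : 0 <= G.[1] - G.[0].
  have := integral0y_rho ltr01 G0; rewrite invr1 mul1r -lee_fin => <-.
  apply: integral_ge0 => y; rewrite /= in_itv/= andbT => y0.
  rewrite lee_fin mul1r -(ger0_norm (sqr_ge0 y)).
  by rewrite (mulr_ge0 y0)// g0.
transitivity (\int[mu2]_p (g (p.1 ^+ 2 + p.2 ^+ 2))%:E)%E.
  apply: eq_integral => p _; rewrite /g ger0_norm//.
  by rewrite addr_ge0// sqr_ge0.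
rewrite ge0_integral_polar//; last exact: continuous_measurable_fun.
transitivity (\int[mu]_t (2 * (G.[1] - G.[0]) * (oneDsqr t)^-1)%:E)%E.
  apply: eq_integral => t _.
  have t0 : 0 < 1 + t ^+ 2 by rewrite ltr_pwDl// sqr_ge0.
  rewrite ge0_symfun_integralT//=.
  - rewrite -set_itvcy.
    transitivity (2 * ((1 + t ^+ 2)^-1 * (G.[1] - G.[0]))%:E)%E.
      rewrite -(integral0y_rho t0 G0); congr (_ * _)%E.
      apply: eq_integral => y; rewrite inE/= in_itv/= andbT => y0.
      have ty : 0 <= (1 + t ^+ 2) * y ^+ 2 by rewrite mulr_ge0 ?sqr_ge0// ltW.
      by rewrite (mulrC (y ^+ 2)) /g (ger0_norm y0) (ger0_norm ty).
    by rewrite -EFinM; congr EFin; rewrite /oneDsqr; ring.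
  - by move=> y; rewrite mulr_ge0.
  - move=> y; apply: cvgM; first exact: norm_continuous.
    apply: (continuous_comp (f := fun y : R => y ^+ 2 * (1 + t ^+ 2))).
      by apply: cvgMr_tmp; exact: exprn_continuous.
    exact: cg.
  - by move=> y/=; rewrite normrN sqrrN.
under eq_integral do rewrite EFinM.
rewrite ge0_integralZl//=; last 2 first.
- apply/measurable_EFinP; apply: continuous_measurable_fun.
  exact: continuous_oneDsqrV.
- by rewrite lee_fin (mulr_ge0 _ GG).
rewrite ge0_symfun_integralT//=.
- rewrite -set_itvcy integral0y_oneDsqr -!EFinM; congr EFin.
  by field.
- exact: continuous_oneDsqrV.
- by move=> t/=; rewrite /oneDsqr sqrrN.
Qed.

End radial.

(** * Integrability, linearity and radial moments for m *)

Section moments.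
Context {R : realType}.
Local Notation mu2 := (@lebesgue_measure R \x @lebesgue_measure R)%E.
Implicit Types (f g : R[i] -> R) (z : R[i]).

Definition measurable_m f :=
  measurable_fun setT (fun p : R * R => f (p.1 +i* p.2)%C).

Definition integrable_m f := mu2.-integrable setT (EFin \o density f).

Lemma sqmod_split (p : R * R) : sqmod (p.1 +i* p.2)%C = p.1 ^+ 2 + p.2 ^+ 2.
Proof. exact: sqmodE. Qed.

Lemma rho_sqmod_gt0 z : 0 < rho (sqmod z).
Proof. by rewrite rho_gt0// sqmod_ge0. Qed.

Lemma densityE f (p : R * R) :
  density f p = f (p.1 +i* p.2)%C * rho (sqmod (p.1 +i* p.2)%C) ^+ 4 / pi.
Proof.
rewrite /density invfM -exprVn -rho_sqr ?sqmod_ge0// -exprM.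
by rewrite mulrA mulrAC.
Qed.

Lemma measurable_rho_sqmod n : measurable_m (fun z => rho (sqmod z) ^+ n).
Proof.
apply: measurable_funX => /=.
under eq_fun do rewrite -(ger0_norm (sqmod_ge0 _)).
exact: measurableT_comp measurable_rho_norm measurable_sqmod.
Qed.

(** The density of m is [rho^4 / pi], so the integrand is dominated by [K rho^3 / pi], integrable by
    the radial formula with [G = 'X]. The spare factor [rho] leaves room for logarithmic growth. *)
Lemma integrable_m_bound f (K : R) : measurable_m f ->
  (forall z, `|f z| * rho (sqmod z) <= K) -> integrable_m f.
Proof.
move=> mf fK.
have K0 : 0 <= K by rewrite (le_trans _ (fK 0))// mulr_ge0// ltW// rho_sqmod_gt0.
have d1 : ('X : {poly R})^`() = 1 by rewrite derivX.
have X0 v : 0 <= v <= 1 -> 0 <= ('X : {poly R})^`().[v] by rewrite d1 hornerC ler01.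
have h := ge0_integral_radial X0.
have hg : mu2.-integrable setT (fun p : R * R =>
    (K / pi)%:E * (rho (p.1 ^+ 2 + p.2 ^+ 2) ^+ 3)%:E)%E.
  apply: integrableZl => //; apply/integrableP; split.
    apply/measurable_EFinP; under eq_fun do rewrite -sqmod_split.
    exact: measurable_rho_sqmod.
  suff -> : (\int[mu2]_p `|(rho (p.1 ^+ 2 + p.2 ^+ 2) ^+ 3)%:E| =
      (2 * pi * (('X : {poly R}).[1] - ('X : {poly R}).[0]))%:E)%E by rewrite ltry.
  rewrite -h; apply: eq_integral.
  move=> p _; rewrite d1 hornerC mul1r gee0_abs// lee_fin exprn_ge0// ltW//.
  by rewrite rho_gt0// addr_ge0// sqr_ge0.
apply: (le_integrable _ _ _ hg) => //.
  by apply/measurable_EFinP; exact: measurable_density.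
move=> p _; rewrite -EFinM /= lee_fin densityE -sqmod_split.
set z := (_ +i* _)%C.
have r0 := rho_sqmod_gt0 z.
rewrite [leRHS]ger0_norm; last first.
  by rewrite mulr_ge0 ?exprn_ge0 ?(ltW r0)// divr_ge0// pi_ge0.
rewrite normrM normrM (ger0_norm (exprn_ge0 _ (ltW r0))).
have pi1 : 0 <= (pi : R)^-1 by rewrite invr_ge0 pi_ge0.
rewrite (ger0_norm pi1) [leRHS]mulrAC ler_wpM2r// exprS mulrA.
by rewrite ler_wpM2r ?exprn_ge0 ?(ltW r0).
Qed.

(** Of the weight [rho^4 / pi], three powers are the Jacobian and one joins [f], so [pi G'(v) = f v]
    and the integral is [2 pi (G(1) - G(0))]. A cubic in [v^2] is enough for [(1 - v^2)^k] with
    [k <= 3]. *)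
Lemma integral_m_radial (a0 a1 a2 a3 : R) m f :
  (forall v, 0 <= v <= 1 ->
     0 <= a0 + a1 * v ^+ 2 + a2 * v ^+ 4 + a3 * v ^+ 6) ->
  (forall z, let v := rho (sqmod z) in f z * v =
     v ^+ m * (a0 + a1 * v ^+ 2 + a2 * v ^+ 4 + a3 * v ^+ 6)) ->
  integral_m f = 2 * (a0 / m.+1%:R + a1 / m.+3%:R + a2 / m.+4.+1%:R
    + a3 / m.+4.+3%:R).
Proof.
move=> a_ge0 fE.
pose G : {poly R} := pi^-1 *: (
  (a0 / m.+1%:R) *: 'X^(m.+1) + (a1 / m.+3%:R) *: 'X^(m.+3) + (a2 / m.+4.+1%:R) *: 'X^(m.+4.+1) + (a3 / m.+4.+3%:R) *: 'X^(m.+4.+3)).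
have GE v : G^`().[v] = pi^-1 *
    (v ^+ m * (a0 + a1 * v ^+ 2 + a2 * v ^+ 4 + a3 * v ^+ 6)).
  have dX c n : ((c / n.+1%:R) *: 'X^(n.+1))^`().[v] = c * v ^+ n.
    rewrite derivZ derivXn hornerZ hornerMn hornerXn
      -(mulr_natl (v ^+ _)) mulrA divfK//.
  rewrite derivZ !derivD hornerZ !hornerD !dX; congr (_ * _).
  by rewrite !exprS; ring.
have G0 v : 0 <= v <= 1 -> 0 <= G^`().[v].
  move=> v01; rewrite GE mulr_ge0 ?invr_ge0 ?pi_ge0// mulr_ge0 ?a_ge0//.
  by case/andP: v01 => v0 _; rewrite exprn_ge0.
rewrite /integral_m /Rintegral.
transitivity (fine (\int[mu2]_p (G^`().[rho (p.1 ^+ 2 + p.2 ^+ 2)] *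
                rho (p.1 ^+ 2 + p.2 ^+ 2) ^+ 3)%:E)%E).
  congr fine; apply: eq_integral => p _; congr EFin.
  rewrite -/(density f p) densityE -sqmod_split GE -fE.
  by ring.
rewrite ge0_integral_radial//= /G !hornerZ !hornerD !hornerZ !hornerXn.
have pi0 : (pi : R) != 0 by rewrite gt_eqF// pi_gt0.
rewrite !expr0n/= !expr1n -mulrBr -(mulrA 2) (mulrA pi) divff// mul1r.
by rewrite !mulr1 !mulr0 !addr0 subr0.
Qed.

Lemma integral_mD f g : integrable_m f -> integrable_m g ->
  integral_m (fun z => f z + g z) = integral_m f + integral_m g.
Proof.
move=> fi gi; rewrite /integral_m -RintegralD//.
by apply: eq_Rintegral => p _; rewrite mulrDl.
Qed.

Lemma integral_mB f g : integrable_m f -> integrable_m g ->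
  integral_m (fun z => f z - g z) = integral_m f - integral_m g.
Proof.
move=> fi gi; rewrite /integral_m -RintegralB//.
by apply: eq_Rintegral => p _; rewrite mulrBl.
Qed.

Lemma integral_mZ (c : R) f : integrable_m f ->
  integral_m (fun z => c * f z) = c * integral_m f.
Proof.
move=> fi; rewrite /integral_m -RintegralZl//.
by apply: eq_Rintegral => p _; rewrite mulrA.
Qed.

Lemma weight_ge0 (t : R) z : 0 <= t -> 0 <= t / (pi * (1 + sqmod z) ^+ 2).
Proof.
move=> t0; rewrite divr_ge0// mulr_ge0 ?pi_ge0// exprn_ge0//.
by rewrite addr_ge0// sqmod_ge0.
Qed.

Lemma integral_m_ge0 f : (forall z, 0 <= f z) -> 0 <= integral_m f.
Proof. by move=> f0; apply: Rintegral_ge0 => p _; exact: weight_ge0. Qed.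

Lemma le_integral_m f g : integrable_m f -> integrable_m g ->
  (forall z, f z <= g z) -> integral_m f <= integral_m g.
Proof.
move=> fi gi fg; apply: le_Rintegral => // p _; rewrite -subr_ge0 -mulrBl.
by rewrite weight_ge0// subr_ge0.
Qed.

Lemma integrable_mD f g : integrable_m f -> integrable_m g ->
  integrable_m (fun z => f z + g z).
Proof.
move=> fi gi; have := integrableD measurableT fi gi; congr (integrable _ _ _).
by apply/funext => p; rewrite /= -EFinD -mulrDl.
Qed.

Lemma integrable_mZ (c : R) f : integrable_m f -> integrable_m (fun z => c * f z).
Proof.
move=> fi; have := integrableZl measurableT c fi; congr (integrable _ _ _).
by apply/funext => p; rewrite /= -EFinM mulrA.
Qed.

Lemma integrable_m_sum n (f : nat -> R[i] -> R) :
  (forall j, (j < n)%N -> integrable_m (f j)) ->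
  integrable_m (fun z => \sum_(j < n) f j z) /\
  integral_m (fun z => \sum_(j < n) f j z) = \sum_(j < n) integral_m (f j).
Proof.
elim: n => [|n ih] fi.
  under eq_fun do rewrite big_ord0.
  split.
    apply: (integrable_m_bound (K := 0)) => [|z]; first exact: measurable_cst.
    by rewrite normr0 mul0r.
  rewrite big_ord0 /integral_m.
  by under eq_Rintegral do rewrite mul0r; rewrite Rintegral_cst// mul0r.
have [i1 i2] := ih (fun j jn => fi j (ltnW jn)).
under eq_fun do rewrite big_ord_recr/=.
split; first by apply: integrable_mD => //; exact: fi.
by rewrite integral_mD//; [rewrite i2 big_ord_recr|exact: fi].
Qed.

End moments.

(** * Extraction of coefficients by averaging over roots of unity *)

Section coefficients.
Context {R : realType}.
Implicit Types (P : {poly R[i]}) (z : R[i]).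

(** Cauchy-Schwarz against the constant vector, applied to real and imaginary parts. *)
Lemma sqmodD_le n (a : nat -> R[i]) :
  sqmod (\sum_(j < n) a j) <= n%:R * \sum_(j < n) sqmod (a j).
Proof.
have realE m (x : nat -> R) :
    (\sum_(j < m) x j) ^+ 2 <= m%:R * \sum_(j < m) x j ^+ 2.
  elim: m => [|m ih]; first by rewrite !big_ord0 expr0n mul0r.
  rewrite !big_ord_recr/=; move: ih; set S := \sum_(j < m) x j.
  set Q := \sum_(j < m) _; case: m @S @Q => [|m] S Q ih.
    by rewrite /S /Q !big_ord0 !add0r mul1r.
  have m0 : 0 < m.+1%:R :> R by rewrite ltr0n.
  rewrite -(ler_pM2l m0) [m.+2%:R](mulrS 1).
  (* This square bounds the cross term of [(S + x)^2] once the goal is multiplied by [m + 1]. *)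
  have := sqr_ge0 (S - m.+1%:R * x m.+1).
  have := ler_wpM2l (ltW m0) ih.
  move: (m.+1%:R) m0 ih => t t0 ih; lra.
rewrite sqmodE !raddf_sum/=; under [X in _ <= _ * X]eq_bigr do rewrite sqmodE.
rewrite big_split/= mulrDr; apply: lerD.
  exact: (realE n (fun j => complex.Re (a j))).
exact: (realE n (fun j => complex.Im (a j))).
Qed.

Lemma sqmod_natr n : sqmod (n%:R : R[i]) = n%:R ^+ 2.
Proof.
have -> : (n%:R : R[i]) = (n%:R)%:C%C by rewrite rmorph_nat.
by rewrite sqmodE/= expr0n addr0.
Qed.

(** ['X^n - 1] splits over the algebraically closed field and is separable, so it has [n] distinct
    roots, one of which is primitive. *)
Lemma exists_prim_root n : (0 < n)%N -> exists w : R[i], n.-primitive_root w.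
Proof.
move=> n0; have [r] := closed_field_poly_normal ('X^n - 1 : {poly R[i]}).
rewrite (monicP (monicXnsubC _ n0)) scale1r => rE.
have r_roots : all n.-unity_root r.
  by apply/allP => w wr; rewrite /root_of_unity rE root_prod_XsubC.
have r_uniq : uniq r.
  by rewrite -separable_prod_XsubC -rE separable_Xn_sub_1// pnatr_eq0 -lt0n.
have r_size : (n <= size r)%N.
  by rewrite -ltnS -(size_prod_XsubC r id) -rE size_XnsubC.
by have /hasP[w _ pw] := has_prim_root n0 r_roots r_uniq r_size; exists w.
Qed.

Lemma sum_prim_root n (w : R[i]) k : n.-primitive_root w ->
  \sum_(j < n) (w ^+ k) ^+ j = if (n %| k)%N then n%:R else 0.
Proof.
move=> pw; case: ifPn => [|] nk.
  move: nk; rewrite (prim_order_dvd pw) => /eqP ->.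
  under eq_bigr do rewrite expr1n.
  by rewrite sumr_const card_ord.
rewrite (prim_order_dvd pw) in nk.
have := subrX1 (w ^+ k) n.
rewrite -exprM mulnC exprM (prim_expr_order pw) expr1n subrr.
by move/esym/eqP; rewrite mulf_eq0 subr_eq0 (negPf nk)/= => /eqP.
Qed.

(** A discrete Fourier coefficient: as [w^n = 1], the exponent [n - k] stands for [-k], and [n > N]
    keeps distinct degrees apart. *)
Lemma coef_average N P n (w : R[i]) k z : (size P <= N.+1)%N -> (k <= N)%N ->
  (N < n)%N -> n.-primitive_root w ->
  \sum_(j < n) (w ^+ j) ^+ (n - k) * P.[w ^+ j * z] = n%:R * (P`_k * z ^+ k).
Proof.
move=> sP kN Nn pw; have kn := leq_ltn_trans kN Nn.
under eq_bigr do rewrite (horner_coef_wide _ sP) mulr_sumr.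
rewrite exchange_big/= (bigD1 (Ordinal (kN : (k < N.+1)%N)))//= [X in _ + X]big1.
  rewrite addr0 -[n%:R](_ : \sum_(j < n) (w ^+ n) ^+ j = _).
    rewrite mulr_suml; apply: eq_bigr => j _.
    have wE : w ^+ (j * (n - k)) * w ^+ (j * k) = w ^+ (n * j).
      by rewrite -exprD -mulnDr (subnK (ltnW kn)) mulnC.
    by rewrite exprMn -!exprM -wE; ring.
  by rewrite sum_prim_root// dvdnn.
move=> i ik.
transitivity (\sum_(j < n) (w ^+ (i + (n - k))) ^+ j * (P`_i * z ^+ i)).
  apply: eq_bigr => j _.
  rewrite exprMn -!exprM (mulnC _ j) mulnDr exprD; ring.
rewrite -mulr_suml sum_prim_root// ifN ?mul0r//.
have iN : (i <= N)%N by rewrite -ltnS.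
have {}ik : (i : nat) != k by [].
(* [i + (n - k)] lies strictly between 0 and [2 n], so divisibility by [n] would force [i = k]. *)
apply/negP => /dvdnP[[|[|q]]]; lia.
Qed.

End coefficients.

(** * Husimi densities and the coefficient bound *)

Section husimi.
Context {R : realType}.
Implicit Types (P : {poly R[i]}) (z : R[i]).

Lemma husimiE N P z : husimi N P z = sqmod P.[z] * rho (sqmod z) ^+ (2 * N).
Proof. by rewrite /husimi exprM rho_sqr ?sqmod_ge0// exprVn. Qed.

Lemma husimi_ge0 N P z : 0 <= husimi N P z.
Proof. by rewrite husimiE mulr_ge0 ?sqmod_ge0// exprn_ge0// ltW// rho_sqmod_gt0. Qed.

Lemma measurable_sqmod_horner P : measurable_m (fun z => sqmod P.[z]).
Proof.
suff [mRe mIm] : measurable_m (fun z => complex.Re P.[z]) /\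
                 measurable_m (fun z => complex.Im P.[z]).
  rewrite /measurable_m; under eq_fun do rewrite sqmodE.
  by apply: measurable_funD; exact: measurable_funX.
elim/poly_ind: P => [|P c [mRe mIm]].
  by split; rewrite /measurable_m; under eq_fun do rewrite horner0;
    exact: measurable_cst.
split; rewrite /measurable_m.
  rewrite (_ : (fun _ => _) = fun p : R * R =>
    complex.Re P.[p.1 +i* p.2]%C * p.1 - complex.Im P.[p.1 +i* p.2]%C * p.2 + complex.Re c).
    apply: measurable_funD => //; apply: measurable_funB.
      exact: measurable_funM mRe measurable_fst.
    exact: measurable_funM mIm measurable_snd.
  apply/funext => -[x y]; rewrite hornerMXaddC/=.
  by case: P.[_] => a b; case: c.
rewrite (_ : (fun _ => _) = fun p : R * R =>
  complex.Re P.[p.1 +i* p.2]%C * p.2 + complex.Im P.[p.1 +i* p.2]%C * p.1 + complex.Im c).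
  apply: measurable_funD => //; apply: measurable_funD.
    exact: measurable_funM mRe measurable_snd.
  exact: measurable_funM mIm measurable_fst.
apply/funext => -[x y]; rewrite hornerMXaddC/=.
by case: P.[_] => a b; case: c.
Qed.

Lemma measurable_husimi N P : measurable_m (husimi N P).
Proof.
rewrite /measurable_m; under eq_fun do rewrite husimiE.
apply: measurable_funM; first exact: measurable_sqmod_horner.
exact: measurable_rho_sqmod.
Qed.

(** Cauchy-Schwarz on the monomials, together with [|z|^(2 i) <= (1 + |z|^2)^N] for [i <= N]. *)
Lemma husimi_bounded N P : (size P <= N.+1)%N ->
  exists2 K : R, 0 <= K & forall z, husimi N P z <= K.
Proof.
move=> sP; exists (N.+1%:R * \sum_(i < N.+1) sqmod P`_i) => [|z].
  by rewrite mulr_ge0// sumr_ge0// => i _; rewrite sqmod_ge0.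
have s0 := sqmod_ge0 z; have s1 : 0 < (1 + sqmod z) ^+ N.
  by rewrite exprn_gt0// ltr_pwDl.
rewrite ler_pdivrMr// (horner_coef_wide _ sP).
rewrite (le_trans (sqmodD_le _ (fun i => P`_i * z ^+ i)))//.
rewrite -mulrA ler_wpM2l// mulr_suml ler_sum// => i _.
rewrite sqmodM sqmodX ler_wpM2l ?sqmod_ge0//.
apply: (@le_trans _ _ ((1 + sqmod z) ^+ i)).
  by rewrite lerXn2r// ?nnegrE ?addr_ge0// lerDr.
by rewrite ler_weXn2l ?lerDl// -ltnS.
Qed.

Lemma integrable_husimi N P : (size P <= N.+1)%N -> integrable_m (husimi N P).
Proof.
move=> sP; have [K K0 PK] := husimi_bounded sP.
apply: (integrable_m_bound (K := K)); first exact: measurable_husimi.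
move=> z; rewrite ger0_norm ?husimi_ge0// -[leRHS]mulr1.
by rewrite ler_pM ?husimi_ge0 ?PK ?rho_le1 ?sqmod_ge0 ?(ltW (rho_sqmod_gt0 _)).
Qed.

Lemma normN_sqr N P : normN N P ^+ 2 = N.+1%:R * integral_m (husimi N P).
Proof.
rewrite sqr_sqrtr// mulr_ge0// integral_m_ge0// => z; exact: husimi_ge0.
Qed.

(** Cauchy-Schwarz on the average over rotations bounds [n^2 |c_k z^k|^2] by [n] times the sum of
    the [|P(w^j z)|^2]; all rotated copies have the same integral. The factor on the left is the
    squared norm of ['X^k]. *)
Lemma coef_le_normN N P k : (size P <= N.+1)%N -> (k <= N)%N ->
  N.+1%:R * integral_m (husimi N 'X^k) * sqmod P`_k <= normN N P ^+ 2.
Proof.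
(* The order exceeds [N], as coefficient extraction requires, and is odd, so no power of [w] is the
   excluded rotation -1. *)
move=> sP kN; pose n := (2 * N).+1.
have [w pw] := exists_prim_root (R := R) (ltn0Sn (2 * N)).
have w1 : sqmod w = 1.
  apply/eqP; rewrite -(@pexpr_eq1 _ _ n) ?sqmod_ge0//.
  by rewrite -sqmodX (prim_expr_order pw) sqmodE/= expr1n expr0n/= addr0.
have wj1 j : sqmod (w ^+ j) = 1 by rewrite sqmodX w1 expr1n.
have wjN1 j : w ^+ j != -1.
  apply/eqP => wj; have : (w ^+ j) ^+ n = 1.
    by rewrite -exprM mulnC exprM (prim_expr_order pw) expr1n.
  rewrite wj -signr_odd /n/= mul2n odd_double/= expr1 => /eqP.
  by rewrite eq_sym -subr_eq0 opprK -mulr2n pnatr_eq0.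
have sX : (size ('X^k : {poly R[i]}) <= N.+1)%N by rewrite size_polyXn.
have iX := integrable_husimi sX.
have rot j : integral_m (fun z => husimi N P (w ^+ j * z)) = integral_m (husimi N P).
  by apply: integral_m_rotation => //; exact: measurable_husimi.
have irot j : integrable_m (fun z => husimi N P (w ^+ j * z)).
  have [K K0 PK] := husimi_bounded sP.
  apply: (integrable_m_bound (K := K)) => [|z].
    have -> : (fun z => husimi N P (w ^+ j * z)) =
        husimi N (P \Po (w ^+ j *: 'X)).
      apply/funext => z; rewrite !husimiE horner_comp hornerZ hornerX.
      by rewrite sqmodM wj1 mul1r.
    exact: measurable_husimi.
  rewrite ger0_norm ?husimi_ge0// -[leRHS]mulr1.
  by rewrite ler_pM ?husimi_ge0 ?PK ?rho_le1 ?sqmod_ge0 ?(ltW (rho_sqmod_gt0 _)).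
have [is1 is2] := integrable_m_sum (n := n) (fun j _ => irot j).
have : integral_m (fun z => n%:R ^+ 2 * sqmod P`_k * husimi N 'X^k z) <=
    integral_m (fun z => n%:R * \sum_(j < n) husimi N P (w ^+ j * z)).
  apply: le_integral_m => [||z]; [exact: integrable_mZ|exact: integrable_mZ|].
  under eq_bigr do rewrite husimiE sqmodM wj1 mul1r.
  rewrite -mulr_suml husimiE mulrA [leRHS]mulrA ler_wpM2r//.
    by rewrite exprn_ge0// ltW// rho_sqmod_gt0.
  rewrite hornerXn -mulrA -sqmodM -sqmod_natr -sqmodM.
  rewrite -(coef_average z sP kN _ pw); last by rewrite /n; lia.
  apply: le_trans (sqmodD_le _ (fun j => (w ^+ j) ^+ (n - k) * P.[w ^+ j * z])) _.
  rewrite ler_wpM2l// ler_sum// => j _.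
  by rewrite sqmodM sqmodX wj1 expr1n mul1r.
rewrite !integral_mZ// is2; under eq_bigr do rewrite rot.
rewrite sumr_const card_ord -(mulr_natl (integral_m _)) [leRHS]mulrA -expr2 -mulrA.
rewrite ler_pM2l ?exprn_gt0 ?ltr0n// => h.
by rewrite normN_sqr -mulrA ler_wpM2l// mulrC.
Qed.

(** With [v = rho (|z|^2)] one has [|z|^2 v^2 = 1 - v^2], so the Husimi density times [v] is
    [v^(2 N + 1 - 2 k) (1 - v^2)^k]: a Beta integral. *)
Lemma integral_m_husimiXn N k m (a1 a2 a3 : R) : (m + 2 * k = 2 * N + 1)%N ->
  (forall v : R, (1 - v ^+ 2) ^+ k = 1 + a1 * v ^+ 2 + a2 * v ^+ 4 + a3 * v ^+ 6) ->
  integral_m (husimi N 'X^k) =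
  2 * (1 / m.+1%:R + a1 / m.+3%:R + a2 / m.+4.+1%:R + a3 / m.+4.+3%:R).
Proof.
move=> mE aE; apply: integral_m_radial => [v|z] /=.
  move=> /andP[v0 v1]; rewrite -aE exprn_ge0// subr_ge0 expr_le1//.
set v := rho _; rewrite -aE husimiE hornerXn sqmodX -/v.
have v0 : 0 < v := rho_sqmod_gt0 z.
have -> : 1 - v ^+ 2 = sqmod z * v ^+ 2.
  rewrite rho_sqr ?sqmod_ge0//; have := sqmod_ge0 z; move: (sqmod z) => s s0.
  by field; rewrite gt_eqF// ltr_pwDl.
rewrite -mulrA -exprSr -addn1 -mE exprD exprM [(sqmod z * _) ^+ k]exprMn.
ring.
Qed.

End husimi.

(** * Logarithmic estimates and the entropy deficit *)

Section entropy.
Context {R : realType}.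
Implicit Types (P : {poly R[i]}) (z : R[i]).

Definition logw z : R := ln (1 + sqmod z).

Lemma logw_ge0 z : 0 <= logw z.
Proof. by rewrite ln_ge0// lerDl sqmod_ge0. Qed.

(** With [w = sqrt (1 + |z|^2)]: [2 ln w <= 2 (w - 1) <= 2 (w^2 - 1) / w]. This form of the bound
    keeps later integrands polynomial in [rho]. *)
Lemma logw_le z : logw z <= 2 * (sqmod z * rho (sqmod z)).
Proof.
have := sqmod_ge0 z; rewrite /logw /rho; move: (sqmod z) => s s0.
have s1 : 0 < 1 + s by rewrite ltr_pwDl.
have w2 := sqr_sqrtr (ltW s1).
have : 1 <= Num.sqrt (1 + s) by rewrite -[leLHS]sqrtr1 ler_sqrt; lra.
move: (Num.sqrt _) w2 => w w2 w1; have w0 : 0 < w := lt_le_trans ltr01 w1.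
rewrite -w2 lnXn// -(mulr_natl (ln w)) ler_pM2l//.
apply: (@le_trans _ _ (w - 1)).
  by rewrite -ler_expR lnK//; have := expR_ge1Dx (w - 1); lra.
have -> : s = w ^+ 2 - 1 by rewrite w2; ring.
rewrite ler_pdivlMr//; nra.
Qed.

Lemma logw_rho_le z : logw z * rho (sqmod z) <= 2.
Proof.
have r0 := rho_sqmod_gt0 z.
apply: le_trans (ler_wpM2r (ltW r0) (logw_le z)) _.
have := rho_sqr (sqmod_ge0 z); move: (rho _) => r.
move: (sqmod z) (sqmod_ge0 z) => s s0.
rewrite expr2 -!mulrA => ->; rewrite ger_pMr// ler_pdivrMr ?mul1r ?lerDr//.
by rewrite ltr_pwDl.
Qed.

Lemma measurable_logw : measurable_m logw.
Proof.
apply: (measurableT_comp (@measurable_ln R)); apply: measurable_funD => //.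
exact: measurable_sqmod.
Qed.

Lemma integrable_mul_logw (f : R[i] -> R) (K : R) : measurable_m f ->
  (forall z, `|f z| <= K) -> integrable_m (fun z => f z * logw z).
Proof.
move=> mf fK; apply: (integrable_m_bound (K := K * 2)).
  exact: measurable_funM mf measurable_logw.
move=> z; rewrite normrM (ger0_norm (logw_ge0 z)) -mulrA.
by rewrite ler_pM ?logw_rho_le// mulr_ge0 ?logw_ge0// ltW// rho_sqmod_gt0.
Qed.

(** For [v > 0] this is [ln x <= x - 1] at [x = u / v], multiplied by [v]; at [v = 0] it reads
    [- u <= 0]. *)
Lemma gibbs (u v : R) : 0 < u -> 0 <= v -> v * ln u + v - u <= v * ln v.
Proof.
move=> u0; rewrite le_eqVlt => /predU1P[<-|v0].
  by rewrite !mul0r addr0 sub0r oppr_le0 ltW.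
have uv : 0 < u / v by rewrite divr_gt0.
have : ln (u / v) <= u / v - 1.
  by rewrite -ler_expR lnK//; have := expR_ge1Dx (u / v - 1); lra.
rewrite ln_div// -(ler_pM2l v0) mulrBr mulrBr mulr1 mulrC mulrCA divff ?gt_eqF//.
by lra.
Qed.

(** [x - 1 <= x ln x <= x^2] for [x >= 0] makes the integrand bounded. *)
Lemma integrable_m_xlnx (f : R[i] -> R) (K : R) : measurable_m f ->
  (forall z, 0 <= f z) -> (forall z, f z <= K) ->
  integrable_m (fun z => f z * ln (f z)).
Proof.
move=> mf f0 fK; apply: (integrable_m_bound (K := 1 + K ^+ 2)).
  exact: measurable_funM mf (measurableT_comp (@measurable_ln R) mf).
move=> z; have r0 := rho_sqmod_gt0 z.
have K0 : 0 <= K := le_trans (f0 z) (fK z).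
suff h : `|f z * ln (f z)| <= 1 + K ^+ 2.
  rewrite -[leRHS]mulr1; apply: ler_pM => //; first exact: ltW.
  by rewrite rho_le1 ?sqmod_ge0.
have h1 : f z - 1 <= f z * ln (f z).
  by have := gibbs (u := 1) ltr01 (f0 z); rewrite ln1 mulr0 add0r.
have h2 : f z * ln (f z) <= f z * f z.
  rewrite ler_wpM2l//; have [f1|/ln0 ->//] := ltP 0 (f z).
  by rewrite ltW// ln_sublinear.
have h3 : f z * f z <= K ^+ 2 by rewrite expr2 ler_pM.
have := f0 z; rewrite ler_norml => ?; apply/andP; split; have := sqr_ge0 K; lra.
Qed.

Lemma ln_husimi1 N z : ln (husimi N 1 z) = - N%:R * logw z.
Proof.
have s1 : 0 < 1 + sqmod z by rewrite ltr_pwDl// sqmod_ge0.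
rewrite /husimi hornerC sqmodE/= expr1n expr0n addr0 div1r lnV ?posrE ?exprn_gt0//.
by rewrite lnXn// -(mulr_natl (ln _)) mulNr.
Qed.

(* Gibbs' inequality against the Husimi density of 1, whose logarithm is
   [- N * logw]. *)
Lemma wehrl_sub_le N P :
  (size P <= N.+1)%N -> normN N P = 1 -> normN N 1 = 1 :> R ->
  wehrl N P - wehrl N 1 <=
  N.+1%:R * N%:R * integral_m (fun z => (husimi N P z - husimi N 1 z) * logw z).
Proof.
move=> sP nP n1.
have norm_id (Q : {poly R[i]}) : normN N Q = 1 -> normalize N Q = Q.
  by move=> nQ; rewrite /normalize nQ invr1 scale1r.
rewrite /wehrl !norm_id// opprK addrC -mulrBr -mulrA ler_pM2l ?ltr0n//.
have [K K0 PK] := husimi_bounded sP.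
have s1 : (size (1%R : {poly R[i]}) <= N.+1)%N by rewrite size_poly1.
have [K1 K10 PK1] := husimi_bounded s1.
have iP := integrable_husimi sP; have i1 := integrable_husimi s1.
(* Equal total masses cancel the term [v - u] of Gibbs' inequality after integration. *)
have int_eq : integral_m (husimi N P) = integral_m (husimi N 1).
  have h : N.+1%:R * integral_m (husimi N P) = N.+1%:R * integral_m (husimi N 1).
    by rewrite -!normN_sqr nP n1.
  by move: h; apply: mulfI; rewrite pnatr_eq0.
have mP := measurable_husimi N P.
have m1 := measurable_husimi N (1 : {poly R[i]}).
have iPl := integrable_mul_logw mP (K := K).
have {}iPl : integrable_m (fun z => husimi N P z * logw z).
  by apply: iPl => z; rewrite ger0_norm ?husimi_ge0.
have i1l : integrable_m (fun z => husimi N 1 z * logw z).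
  by apply: (integrable_mul_logw m1 (K := K1)) => z; rewrite ger0_norm ?husimi_ge0.
have -> : integral_m (fun z => (husimi N P z - husimi N 1 z) * logw z) =
    integral_m (fun z => husimi N P z * logw z) -
    integral_m (fun z => husimi N 1 z * logw z).
  by rewrite -integral_mB//; congr integral_m; apply/funext => z; rewrite mulrBl.
have -> : (fun z => husimi N 1 z * ln (husimi N 1 z)) =
    (fun z => - N%:R * (husimi N 1 z * logw z)).
  by apply/funext => z; rewrite ln_husimi1 mulrCA.
rewrite integral_mZ//.
have ixl := integrable_m_xlnx mP (husimi_ge0 N P) PK.
have : integral_m (fun z => - N%:R * (husimi N P z * logw z) +
    (husimi N P z + - 1 * husimi N 1 z)) <=
    integral_m (fun z => husimi N P z * ln (husimi N P z)).
  apply: le_integral_m => // [|z].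
    apply: integrable_mD; first exact: integrable_mZ.
    by apply: integrable_mD => //; exact: integrable_mZ.
  have u0 : 0 < husimi N 1 z.
    rewrite husimiE hornerC sqmodE/= expr1n expr0n addr0 mul1r exprn_gt0//.
    exact: rho_sqmod_gt0.
  have := gibbs u0 (husimi_ge0 N P z); rewrite ln_husimi1; lra.
rewrite integral_mD; last 2 first.
- exact: integrable_mZ.
- by apply: integrable_mD => //; exact: integrable_mZ.
rewrite integral_mD//; last exact: integrable_mZ.
rewrite !integral_mZ// int_eq; lra.
Qed.

End entropy.

(** * Explicit moments and the trial polynomial *)

Section trial.
Context {R : realType}.
Implicit Types (P : {poly R[i]}) (z : R[i]).

Lemma integral_m_husimi1 N : N.+1%:R * integral_m (husimi N (1 : {poly R[i]})) = 1 :> R.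
Proof.
rewrite -(expr0 'X) (@integral_m_husimiXn _ N 0 (2 * N).+1 0 0 0); first last.
- by move=> v; rewrite expr0; ring.
- by lia.
rewrite !mul0r !addr0 (_ : (2 * N).+2 = 2 * N.+1)%N; last lia.
by rewrite natrM; field; rewrite nat1r pnatr_eq0.
Qed.

(** The squared norm of ['X^k] is the inverse of [binomial(N, k)], needed for [k = 0, 1, 2]; writing
    [N = n + 2] builds in [N >= 2]. *)
Lemma integral_m_husimiX n :
  n.+3%:R * integral_m (husimi n.+2 ('X^1 : {poly R[i]})) = n.+2%:R^-1 :> R.
Proof.
rewrite (@integral_m_husimiXn _ n.+2 1 (2 * n + 3) (-1) 0 0); first last.
- by move=> v; ring.
- by lia.
rewrite !mul0r !addr0 (_ : (2 * n + 3).+3 = 2 * n.+3)%N; last lia.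
rewrite (_ : (2 * n + 3).+1 = 2 * n.+2)%N; last lia.
rewrite !natrM -!natr1; move: (n%:R) (ler0n R n) => x x0.
by field; do ?[apply/andP; split]; rewrite gt_eqF//; lra.
Qed.

Lemma bin2_natrE n : ('C(n.+2, 2)%:R : R) = n.+2%:R * n.+1%:R / 2.
Proof.
apply: (mulIf (x := 2)) => //; rewrite divfK// -!natrM; congr (_%:R).
rewrite bin2; have := odd_double_half (n.+2 * n.+1).
by rewrite oddM/= negbK andbN; lia.
Qed.

Lemma integral_m_husimiX2 n :
  n.+3%:R * integral_m (husimi n.+2 ('X^2 : {poly R[i]})) = 'C(n.+2, 2)%:R^-1 :> R.
Proof.
rewrite (@integral_m_husimiXn _ n.+2 2 (2 * n + 1) (-2) 1 0); first last.
- by move=> v; ring.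
- by lia.
rewrite !mul0r !addr0 (_ : (2 * n + 1).+4.+1 = 2 * n.+3)%N; last lia.
rewrite (_ : (2 * n + 1).+3 = 2 * n.+2)%N; last lia.
rewrite (_ : (2 * n + 1).+1 = 2 * n.+1)%N; last lia.
rewrite bin2_natrE !natrM -!natr1; move: (n%:R) (ler0n R n) => x x0.
by field; do ?[apply/andP; split]; rewrite gt_eqF//; lra.
Qed.

(** By [logw_le], the integrand times [v = rho (|z|^2)] is at most [2 v^(2 n) (1 - v^2)^3]. The
    resulting rational function of [n] is bounded by 12 uniformly. *)
Lemma integral_m_husimiX2_logw n :
  n.+3%:R * n.+2%:R * 'C(n.+2, 2)%:R *
    integral_m (fun z => husimi n.+2 ('X^2 : {poly R[i]}) z * logw z) <= 12.
Proof.
have sX : (size ('X^2 : {poly R[i]}) <= n.+3)%N by rewrite size_polyXn.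
have [K K0 XK] := husimi_bounded sX.
have mX := measurable_husimi n.+2 ('X^2 : {poly R[i]}).
pose f (z : R[i]) := husimi n.+2 'X^2 z * (2 * (sqmod z * rho (sqmod z))).
have fE : integral_m f = 2 * (2 / (2 * n).+1%:R + (- 6) / (2 * n).+3%:R +
    6 / (2 * n).+4.+1%:R + (- 2) / (2 * n).+4.+3%:R).
  apply: integral_m_radial => [v /andP[v0 v1]|z] /=.
    rewrite (_ : _ + _ = 2 * (1 - v ^+ 2) ^+ 3); last by ring.
    by rewrite mulr_ge0// exprn_ge0// subr_ge0 expr_le1.
  rewrite /f husimiE hornerXn sqmodX.
  have := rho_sqr (sqmod_ge0 z); move: (rho _) => r.
  move: (sqmod z) (sqmod_ge0 z) => s s0 r2.
  have s1 : 1 + s != 0 by rewrite gt_eqF// ltr_pwDl.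
  have -> : 2 + - 6 * r ^+ 2 + 6 * r ^+ 4 + - 2 * r ^+ 6 =
      2 * (1 - r ^+ 2) ^+ 3 by ring.
  have -> : 1 - r ^+ 2 = s * r ^+ 2 by rewrite r2; field.
  rewrite (_ : 2 * n.+2 = 2 * n + 4)%N; last lia.
  by rewrite exprD; ring.
have lef : integral_m (fun z : R[i] => husimi n.+2 'X^2 z * logw z) <=
    integral_m f.
  apply: le_integral_m.
  - by apply: (integrable_mul_logw mX (K := K)) => z; rewrite ger0_norm ?husimi_ge0.
  - apply: (integrable_m_bound (K := K * 2)).
      apply: measurable_funM => //; apply: measurable_funM => //.
      apply: measurable_funM; first exact: measurable_sqmod.
      exact: (measurable_rho_sqmod 1).
    move=> z; have sr0 := le_trans (logw_ge0 z) (logw_le z).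
    rewrite /f ger0_norm; last by rewrite mulr_ge0 ?husimi_ge0.
    rewrite -(mulrA (husimi _ _ _)); apply: ler_pM => //; first exact: husimi_ge0.
      by rewrite (mulr_ge0 sr0)// ltW// rho_sqmod_gt0.
    have := rho_sqr (sqmod_ge0 z); move: (rho _) => r.
    move: (sqmod z) (sqmod_ge0 z) => s s0.
    rewrite expr2 -!mulrA => ->; rewrite ger_pMr// ler_pdivrMr ?mul1r ?lerDr//.
    by rewrite ltr_pwDl.
  - by move=> z; rewrite ler_wpM2l ?husimi_ge0 ?logw_le.
apply: le_trans (ler_wpM2l _ lef) _; first by rewrite !mulr_ge0.
rewrite fE bin2_natrE -!natr1 natrM.
move: (n%:R) (ler0n R n) => x x0.
set D := (2 * x + 1) * (2 * x + 3) * (2 * x + 5) * (2 * x + 7).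
have D0 : 0 < D by rewrite /D !mulr_gt0//; lra.
rewrite [leLHS](_ : _ = 96 * ((x + 3) * (x + 2) * (x + 2) * (x + 1)) / D); last first.
  by rewrite /D; field; do ?[apply/andP; split]; rewrite gt_eqF//; lra.
rewrite ler_pdivrMr// /D -subr_ge0.
(* All factors are symmetric under [x -> - 4 - x], so they pair into functions of [y], where the
   difference has positive coefficients. *)
set y := x ^+ 2 + 4 * x.
have y0 : 0 <= y by rewrite addr_ge0 ?sqr_ge0// mulr_ge0.
rewrite (_ : _ - _ = 12 * (8 * y ^+ 2 + 32 * y + 9)); last by rewrite /y; ring.
by rewrite mulr_ge0// !addr_ge0// mulr_ge0// sqr_ge0.
Qed.

(** The rotation by ['i] preserves m, so the integral equals its own opposite. *)
Lemma integral_m_odd (f : R[i] -> R) : measurable_m f -> integrable_m f ->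
  (forall z, f ('i%C * z) = - f z) -> integral_m f = 0.
Proof.
move=> mf fi fN.
have i1 : sqmod ('i%C : R[i]) = 1 by rewrite sqmodE/= expr0n expr1n add0r.
have iN1 : ('i%C : R[i]) != -1 by rewrite eq_complex/= oppr0 oner_eq0 andbF.
have := integral_m_rotation i1 iN1 mf.
rewrite (_ : (fun z => _) = (fun z => -1 * f z)); last first.
  by apply/funext => z; rewrite fN mulN1r.
rewrite integral_mZ//; lra.
Qed.

Definition trial (b beta : R) : {poly R[i]} :=
  b%:C%C *: (1 + beta%:C%C *: 'X^2).

(** The interference term [2 Re (z^2) / (1 + |z|^2)^N], written by polarization so that
    measurability and boundedness come from Husimi densities. *)
Definition cross N z : R :=
  husimi N (1 + 'X^2 : {poly R[i]}) z - husimi N 1 z - husimi N 'X^2 z.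

Lemma size_X2 N : (1 < N)%N -> (size ('X^2 : {poly R[i]}) <= N.+1)%N.
Proof. by rewrite size_polyXn. Qed.

Lemma size_1X2 N : (1 < N)%N -> (size ((1 + 'X^2)%R : {poly R[i]}) <= N.+1)%N.
Proof.
move=> N1; rewrite (leq_trans (size_polyD _ _))// geq_max size_poly1/=.
exact: size_X2.
Qed.

Lemma size_trial N b beta : (1 < N)%N -> (size (trial b beta) <= N.+1)%N.
Proof.
move=> N1; rewrite (leq_trans (size_scale_leq _ _))//.
rewrite (leq_trans (size_polyD _ _))// geq_max size_poly1/=.
by rewrite (leq_trans (size_scale_leq _ _))// size_X2.
Qed.

Lemma crossE N z : cross N z =
  2 * complex.Re (z ^+ 2) * rho (sqmod z) ^+ (2 * N).
Proof.
rewrite /cross !husimiE !(hornerD, hornerXn, hornerC) -!mulrBl; congr (_ * _).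
by rewrite !sqmodE/=; case: (z ^+ 2) => x y /=; ring.
Qed.

Lemma husimi_trial N b beta z : husimi N (trial b beta) z =
  b ^+ 2 * (husimi N 1 z + beta * cross N z + beta ^+ 2 * husimi N 'X^2 z).
Proof.
rewrite crossE !husimiE !(hornerZ, hornerD, hornerXn, hornerC).
transitivity (b ^+ 2 *
  (1 + 2 * beta * complex.Re (z ^+ 2) + beta ^+ 2 * sqmod (z ^+ 2)) *
  rho (sqmod z) ^+ (2 * N)).
  congr (_ * _).
  by rewrite !sqmodE/=; case: (z ^+ 2) => x y /=; ring.
rewrite [sqmod 1]sqmodE/= expr1n expr0n addr0; ring.
Qed.

Lemma measurable_cross N : measurable_m (cross N).
Proof.
by apply: measurable_funB; [apply: measurable_funB|]; exact: measurable_husimi.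
Qed.

Lemma cross_rot N z : cross N ('i%C * z) = - cross N z.
Proof.
rewrite !crossE sqmodM.
have -> : sqmod ('i%C : R[i]) = 1 by rewrite sqmodE/= expr0n expr1n add0r.
by rewrite mul1r exprMn sqr_i mulN1r; case: (z ^+ 2) => x y /=; ring.
Qed.

Lemma cross_bounded N : (1 < N)%N -> exists K, forall z, `|cross N z| <= K.
Proof.
move=> N1; have [K1 K10 P1] := husimi_bounded (size_1X2 N1).
have [K2 K20 P2] := husimi_bounded (size_X2 N1).
have s1 : (size (1%R : {poly R[i]}) <= N.+1)%N by rewrite size_poly1.
have [K3 K30 P3] := husimi_bounded s1.
exists (K1 + K2 + K3) => z; rewrite /cross ler_norml.
have := P1 z; have := P2 z; have := P3 z.
have := husimi_ge0 N (1 + 'X^2 : {poly R[i]}) z.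
have := husimi_ge0 N 1 z; have := husimi_ge0 N 'X^2 z.
by move=> *; apply/andP; split; lra.
Qed.

End trial.

(** * Normalization and entropy of the trial family *)

Section deficit.
Context {R : realType}.

(** Since [sqrt 'C(N, 2) 'X^2] is a unit vector orthogonal to 1, the perturbation of 1 has norm
    [|d|] and this factor normalizes the sum. *)
Definition trial_scale (d : R) : R := (Num.sqrt (1 + d ^+ 2))^-1.
Definition trial_coef (N : nat) (d : R) : R := d * Num.sqrt 'C(N, 2)%:R.
Definition trial_family N (d : R) : {poly R[i]} :=
  trial (trial_scale d) (trial_coef N d).

Lemma trial_scale_gt0 d : 0 < trial_scale d.
Proof. by rewrite invr_gt0 sqrtr_gt0 ltr_pwDl// sqr_ge0. Qed.

Lemma trial_scale_sqr d : trial_scale d ^+ 2 = (1 + d ^+ 2)^-1.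
Proof. by rewrite exprVn sqr_sqrtr// addr_ge0// sqr_ge0. Qed.

Lemma trial_coef_sqr N d : trial_coef N d ^+ 2 = d ^+ 2 * 'C(N, 2)%:R.
Proof. by rewrite exprMn sqr_sqrtr. Qed.

Lemma normN1 N : normN N 1 = 1 :> R.
Proof. by rewrite /normN integral_m_husimi1 sqrtr1. Qed.

Lemma integrable_cross N : (1 < N)%N -> integrable_m (@cross R N).
Proof.
move=> N1; have [K PK] := cross_bounded (R := R) N1.
have K0 : 0 <= K := le_trans (normr_ge0 _) (PK 0).
apply: (integrable_m_bound (K := K)); first exact: measurable_cross.
move=> z; rewrite -[leRHS]mulr1 ler_pM ?PK ?rho_le1 ?sqmod_ge0//.
by rewrite ltW// rho_sqmod_gt0.
Qed.

Lemma integral_cross N : (1 < N)%N -> integral_m (@cross R N) = 0.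
Proof.
move=> N1; apply: integral_m_odd; [exact: measurable_cross|exact: integrable_cross|].
exact: cross_rot.
Qed.

Lemma integrable_cross_logw N : (1 < N)%N ->
  integrable_m (fun z : R[i] => cross N z * logw z).
Proof.
move=> N1; have [K PK] := cross_bounded (R := R) N1.
exact: (integrable_mul_logw (measurable_cross N) PK).
Qed.

Lemma integral_cross_logw N : (1 < N)%N ->
  integral_m (fun z : R[i] => cross N z * logw z) = 0.
Proof.
move=> N1; apply: integral_m_odd => [||z].
- exact: measurable_funM (measurable_cross N) measurable_logw.
- exact: integrable_cross_logw.
rewrite cross_rot mulNr; congr (- (_ * _)); rewrite /logw sqmodM.
by rewrite [sqmod 'i%C]sqmodE/= expr0n expr1n add0r mul1r.
Qed.

Lemma bin2_gt0 n : 0 < 'C(n.+2, 2)%:R :> R.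
Proof. by rewrite ltr0n bin_gt0. Qed.

Lemma normN_trial n d : normN n.+2 (trial_family n.+2 d) = 1.
Proof.
have N1 : (1 < n.+2)%N by [].
have iX := integrable_husimi (size_X2 (R := R) N1).
have s1 : (size (1%R : {poly R[i]}) <= n.+3)%N by rewrite size_poly1.
have i1 := integrable_husimi s1.
have ic := integrable_cross N1.
rewrite /normN [integral_m _](_ : _ = trial_scale d ^+ 2 *
  (integral_m (husimi n.+2 (1 : {poly R[i]})) +
   trial_coef n.+2 d ^+ 2 * integral_m (husimi n.+2 ('X^2 : {poly R[i]})))).
  rewrite mulrCA mulrDr integral_m_husimi1 mulrCA integral_m_husimiX2.
  rewrite trial_scale_sqr trial_coef_sqr mulfK ?gt_eqF ?bin2_gt0//.
  by rewrite mulVf ?sqrtr1// gt_eqF// ltr_pwDl// sqr_ge0.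
rewrite (_ : husimi _ _ = fun z => trial_scale d ^+ 2 * (husimi n.+2 1 z +
  trial_coef n.+2 d * cross n.+2 z + trial_coef n.+2 d ^+ 2 * husimi n.+2 'X^2 z)).
  have ic' := integrable_mZ (trial_coef n.+2 d) ic.
  have iX' := integrable_mZ (trial_coef n.+2 d ^+ 2) iX.
  have i1c := integrable_mD i1 ic'.
  rewrite (integral_mZ _ (integrable_mD i1c iX')) (integral_mD i1c iX').
  rewrite (integral_mD i1 ic') (integral_mZ _ ic) (integral_mZ _ iX).
  by rewrite integral_cross// mulr0 addr0.
by apply/funext => z; exact: husimi_trial.
Qed.

(** In the Gibbs bound the cross term integrates to 0 against [logw], the term in the density of 1
    has the coefficient [b^2 - 1 <= 0], and the one in ['X^2] is at most [12 d^2], as [b^2 <= 1]. *)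
Lemma wehrl_trial n d :
  wehrl n.+2 (trial_family n.+2 d) - wehrl n.+2 1 <= 12 * d ^+ 2.
Proof.
have N1 : (1 < n.+2)%N by [].
apply: le_trans (wehrl_sub_le (size_trial _ _ N1) (normN_trial n d) (normN1 _)) _.
have s1 : (size (1%R : {poly R[i]}) <= n.+3)%N by rewrite size_poly1.
have [K1 K10 PK1] := husimi_bounded s1.
have [K2 K20 PK2] := husimi_bounded (size_X2 (R := R) N1).
have i1l : integrable_m (fun z : R[i] => husimi n.+2 1 z * logw z).
  apply: (integrable_mul_logw (measurable_husimi _ _) (K := K1)) => z.
  by rewrite ger0_norm ?husimi_ge0.
have i2l : integrable_m (fun z : R[i] => husimi n.+2 'X^2 z * logw z).
  apply: (integrable_mul_logw (measurable_husimi _ _) (K := K2)) => z.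
  by rewrite ger0_norm ?husimi_ge0.
have icl := integrable_cross_logw N1.
set b := trial_scale d; set beta := trial_coef n.+2 d.
rewrite [integral_m _](_ : _ = (b ^+ 2 - 1) *
    integral_m (fun z : R[i] => husimi n.+2 1 z * logw z) +
  (b ^+ 2 * beta ^+ 2) * integral_m (fun z : R[i] => husimi n.+2 'X^2 z * logw z)).
  have b1 : b ^+ 2 <= 1.
    by rewrite trial_scale_sqr invf_le1 ?lerDl ?sqr_ge0// ltr_pwDl// sqr_ge0.
  have I1 : 0 <= integral_m (fun z : R[i] => husimi n.+2 1 z * logw z).
    by apply: integral_m_ge0 => z; rewrite mulr_ge0 ?husimi_ge0 ?logw_ge0.
  have I2 : 0 <= integral_m (fun z : R[i] => husimi n.+2 'X^2 z * logw z).
    by apply: integral_m_ge0 => z; rewrite mulr_ge0 ?husimi_ge0 ?logw_ge0.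
  have := integral_m_husimiX2_logw (R := R) n; move: I1 I2.
  move: (integral_m (fun z => husimi n.+2 1 z * logw z)) => I1.
  move: (integral_m (fun z => husimi n.+2 'X^2 z * logw z)) => I2 I10 I20.
  rewrite trial_coef_sqr; move: ('C(_, _)%:R) (ler0n R 'C(n.+2, 2)) => c c0 hI.
  have N0 : 0 <= n.+3%:R * n.+2%:R :> R by rewrite mulr_ge0.
  move: (n.+3%:R * n.+2%:R) N0 hI => NN N0 hI.
  have h1 : NN * ((b ^+ 2 - 1) * I1) <= 0.
    by rewrite mulr_ge0_le0// mulr_le0_ge0// subr_le0.
  have h2 : NN * (b ^+ 2 * (d ^+ 2 * c) * I2) <= d ^+ 2 * 12.
    rewrite (_ : _ * _ = b ^+ 2 * (d ^+ 2 * (NN * c * I2))); last by ring.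
    apply: (@le_trans _ _ (1 * (d ^+ 2 * 12))); last by rewrite mul1r.
    have hc : 0 <= NN * c * I2 := mulr_ge0 (mulr_ge0 N0 c0) I20.
    apply: ler_pM; [exact: sqr_ge0| |exact: b1|by rewrite ler_wpM2l ?sqr_ge0].
    exact: mulr_ge0 (sqr_ge0 _) hc.
  by rewrite mulrDr; lra.
rewrite (_ : (fun z => _) = (fun z => (b ^+ 2 - 1) * (husimi n.+2 1 z * logw z) +
  (b ^+ 2 * beta * (cross n.+2 z * logw z) +
   b ^+ 2 * beta ^+ 2 * (husimi n.+2 'X^2 z * logw z)))).
  have j1 := integrable_mZ (b ^+ 2 - 1) i1l.
  have jc := integrable_mZ (b ^+ 2 * beta) icl.
  have j2 := integrable_mZ (b ^+ 2 * beta ^+ 2) i2l.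
  rewrite (integral_mD j1 (integrable_mD jc j2)) (integral_mD jc j2).
  rewrite (integral_mZ _ i1l) (integral_mZ _ icl) (integral_mZ _ i2l).
  by rewrite integral_cross_logw// mulr0 add0r.
by apply/funext => z; rewrite husimi_trial; ring.
Qed.

End deficit.

(** * Distance from the trial family to the kernels *)

Section distance.
Context {R : realType}.

Lemma coef_kernelN N (a : R[i]) k : (kernelN N a)`_k =
  ((1 + sqmod a) `^ (N%:R / 2))^-1%:C%C * ((a^*)%C ^+ k *+ 'C(N, k)).
Proof.
rewrite coefZ; congr (_ * _); rewrite exprDn coef_sum.
under eq_bigr => i _ do rewrite expr1n mul1r coefMn exprZn coefZ coefXn.
have [kN|Nk] := leqP k N.
  rewrite (bigD1 (Ordinal (kN : (k < N.+1)%N)))//= eqxx mulr1 big1 ?addr0// => i ik.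
  by rewrite (_ : (k == i) = false) ?mulr0 ?mul0rn//; apply/negbTE; rewrite eq_sym.
rewrite bin_small// mulr0n big1// => i _.
by rewrite gtn_eqF ?mulr0 ?mul0rn// (leq_trans (ltn_ord i) Nk).
Qed.

Lemma size_kernelN N (a : R[i]) : (size (kernelN N a) <= N.+1)%N.
Proof.
apply/leq_sizeP => k Nk; rewrite coef_kernelN bin_small//.
by rewrite mulr0n mulr0.
Qed.

Lemma sqmod_expi (t : R) : sqmod (expi t) = 1.
Proof. by rewrite sqmodE/= cos2Dsin2. Qed.

Lemma sqmodN (a : R[i]) : sqmod (- a) = sqmod a.
Proof. by rewrite !sqmodE; case: a => x y /=; rewrite !sqrrN. Qed.

Lemma sqmodMn (a : R[i]) n : sqmod (a *+ n) = n%:R ^+ 2 * sqmod a.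
Proof. by rewrite -(mulr_natl a) sqmodM sqmod_natr. Qed.

Lemma sqmodJ (a : R[i]) : sqmod (a^*)%C = sqmod a.
Proof. by rewrite !sqmodE; case: a => x y /=; rewrite sqrrN. Qed.

Lemma sqmodRe (x : R) : sqmod x%:C%C = x ^+ 2.
Proof. by rewrite sqmodE/= expr0n addr0. Qed.

Lemma le_of_sqmodB (x e : R) (w : R[i]) (y : R) : 0 <= e -> 0 <= y ->
  sqmod w = y ^+ 2 -> sqmod (x%:C%C - w) <= e ^+ 2 -> x <= e + y.
Proof.
have nc (u : R[i]) : 0 <= Normc.normc u by case: u => u v; exact: sqrtr_ge0.
move=> e0 y0 wy; rewrite /sqmod ler_pXn2r ?nnegrE// => h.
have {}wy : Normc.normc w = y.
  by apply/eqP; rewrite -(@eqrXn2 _ 2) ?nc//; apply/eqP.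
have xn : x <= Normc.normc (x%:C%C : R[i]).
  by rewrite /= expr0n addr0 sqrtr_sqr ler_norm.
have := le_normcD (x%:C%C - w) w; rewrite subrK wy; lra.
Qed.

(** The coefficients of degrees 0, 1, 2 of the difference control [1 / A], then [N |a|^2], then
    [b d]; here [1 / A] is the constant term of the kernel. *)
Lemma trial_distance n d (a : R[i]) t : 0 < d -> d <= 1 ->
  d / 4 <= normN n.+2 (trial_family n.+2 d - expi t *: kernelN n.+2 a).
Proof.
move=> d0 d1; set P := _ - _; set eta := normN _ P.
have eta0 : 0 <= eta := sqrtr_ge0 _.
pose A : R := (1 + sqmod a) `^ (n.+2%:R / 2).
have s0 := sqmod_ge0 a.
have A1 : 1 <= A.
  have p0 : 0 <= n.+2%:R / 2 :> R by rewrite divr_ge0.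
  have := ge0_ler_powR p0 (x := 1) (y := 1 + sqmod a).
  by rewrite powR1 !nnegrE lerDl addr_ge0//; apply.
have A0 : 0 < A := lt_le_trans ltr01 A1.
have sP : (size P <= n.+3)%N.
  rewrite (leq_trans (size_polyD _ _))// geq_max size_trial//= size_polyN.
  by rewrite (leq_trans (size_scale_leq _ _)) ?size_kernelN.
set b := trial_scale d; have b0 : 0 < b := trial_scale_gt0 d.
set c : R := 'C(n.+2, 2)%:R; have c0 : 0 < c := bin2_gt0 n.
set N : R := n.+2%:R; have N0 : 0 < N by rewrite ltr0n.
have cN : c <= N ^+ 2.
  rewrite /c bin2_natrE /N -[n.+2%:R]natr1 -[n.+1%:R]natr1.
  move: (n%:R) (ler0n R n) => x x0; have := sqr_ge0 x; lra.
have sqc : Num.sqrt c ^+ 2 = c by rewrite sqr_sqrtr// ltW.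
have sqc0 : 0 < Num.sqrt c by rewrite sqrtr_gt0.
have sqcN : Num.sqrt c <= N.
  by rewrite -[leRHS](ger0_norm (ltW N0)) -sqrtr_sqr ler_wsqrtr.
have coefP k : P`_k =
    b%:C%C * ((k == 0%N)%:R + (trial_coef n.+2 d)%:C%C * (k == 2)%:R) -
    expi t * (A^-1%:C%C * ((a^*)%C ^+ k *+ 'C(n.+2, k))).
  rewrite /P coefB; congr (_ - _); last by rewrite coefZ coef_kernelN.
  by rewrite /trial_family /trial coefZ coefD coef1 coefZ coefXn.
have h0 : sqmod P`_0 <= eta ^+ 2.
  have := coef_le_normN sP (leq0n _).
  by rewrite expr0 integral_m_husimi1 mul1r.
have h1 : sqmod P`_1 <= N * eta ^+ 2.
  have := coef_le_normN sP (isT : (1 <= n.+2)%N).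
  by rewrite integral_m_husimiX ler_pdivrMl.
have h2 : sqmod P`_2 <= c * eta ^+ 2.
  have := coef_le_normN sP (isT : (2 <= n.+2)%N).
  by rewrite integral_m_husimiX2 ler_pdivrMl.
have e0 : b <= eta + A^-1.
  apply: (le_of_sqmodB (w := expi t * (A^-1)%:C%C)) => //.
  - by rewrite invr_ge0 ltW.
  - by rewrite sqmodM sqmod_expi mul1r sqmodRe.
  move: h0; rewrite coefP/= mulr0 addr0 mulr1 expr0 bin0 mulr1.
  done.
have e1 : N * sqmod a <= eta ^+ 2 * A ^+ 2.
  move: h1; rewrite coefP/= mulr0 addr0 mulr0 sub0r bin1 expr1 sqmodN.
  rewrite sqmodM sqmod_expi mul1r sqmodM sqmodRe sqmodMn sqmodJ -/N.
  rewrite (_ : _ * _ = N * (N * sqmod a / A ^+ 2)); last first.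
    by field; rewrite gt_eqF.
  by rewrite ler_pM2l// ler_pdivrMr// exprn_gt0.
(* The degree 2 bound divided by [sqrt c], using [sqrt c <= N]. *)
have e2 : b * d <= eta + N * sqmod a / A.
  have : b * trial_coef n.+2 d <= Num.sqrt c * eta + c * sqmod a / A.
    apply: (@le_of_sqmodB _ _
      (expi t * (A^-1%:C%C * ((a^*)%C ^+ 2 *+ 'C(n.+2, 2))))).
    - by rewrite mulr_ge0 ?sqrtr_ge0.
    - by rewrite divr_ge0 ?(ltW A0)// (mulr_ge0 (ltW c0) s0).
    - rewrite sqmodM sqmod_expi mul1r sqmodM sqmodRe sqmodMn sqmodX sqmodJ -/c.
      by move: (sqmod a) => s; field; rewrite gt_eqF.
    move: h2; rewrite coefP/= add0r mulr1 exprMn sqc.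
    by rewrite [(b * _)%:C%C]rmorphM.
  have -> : b * trial_coef n.+2 d = Num.sqrt c * (b * d).
    by rewrite /trial_coef -/c; ring.
  have -> : Num.sqrt c * eta + c * sqmod a / A =
      Num.sqrt c * (eta + Num.sqrt c * sqmod a / A).
    by rewrite -{2}sqc expr2; ring.
  rewrite ler_pM2l// => /le_trans; apply.
  by rewrite lerD2l ler_wpM2r ?invr_ge0 ?(ltW A0)// ler_wpM2r.
have b2 : b ^+ 2 * (1 + d ^+ 2) = 1.
  by rewrite trial_scale_sqr mulVf// gt_eqF// ltr_pwDl// sqr_ge0.
have b12 : 2^-1 <= b.
  rewrite leNgt; apply/negP => bl.
  have : b ^+ 2 * (1 + d ^+ 2) < 1; last by rewrite b2 ltxx.
  have b4 : b ^+ 2 <= 4^-1 by nra.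
  have d2 : d ^+ 2 <= 1 by rewrite expr_le1// ltW.
  have := sqr_ge0 b; nra.
have e3 : b * d <= eta + eta ^+ 2 * A.
  apply: le_trans e2 _; rewrite lerD2l ler_pdivrMr//.
  by rewrite -mulrA -expr2.
(* If [eta >= b], then [eta >= 1/2] already exceeds [d / 4]. *)
have [be|eb] := leP b eta; first by lra.
have e4 : (b - eta) * A <= 1.
  by rewrite -ler_pdivlMr// div1r; lra.
(* Multiplying [e3] by [b - eta] removes the uncontrolled factor [A] through [e4]; the right side
   here equals [b eta]. *)
have e5 : (b - eta) * (b * d) <= (b - eta) * eta + eta ^+ 2.
  have := ler_wpM2l (_ : 0 <= b - eta) e3; rewrite subr_ge0 => /(_ (ltW eb)).
  have := ler_wpM2l (sqr_ge0 eta) e4; nra.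
have : b * (b * d) <= b * (eta * (1 + d)) by nra.
(* What remains is [b d <= eta (1 + d) <= 2 eta], with [b >= 1/2]. *)
rewrite ler_pM2l//; nra.
Qed.

End distance.

Theorem proposition5p1 (R : realType) :
  exists C C' : R, 0 < C /\ 0 < C' /\
    forall N : nat, (2 <= N)%N ->
      exists p : R -> {poly R[i]},
        (forall eps : R, 0 < eps ->
           polys_le N (p eps) /\ normN N (p eps) = 1) /\
        exists eps0 : R, 0 < eps0 /\
          forall eps : R, 0 < eps -> eps < eps0 ->
            C / N%:R * eps ^+ 2 <= distN N (p eps) /\
            wehrl N (p eps) - wehrl N 1 <= C' / N%:R ^+ 2 * eps ^+ 4.
Proof.
(* The constants of [trial_distance] and [wehrl_trial], to be used with [d = eps^2 / N]. *)
exists 4^-1, 12; split; first by rewrite invr_gt0.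
split=> // -[|[|n]]// _.
exists (fun eps => trial_family n.+2 (eps ^+ 2 / n.+2%:R)); split=> [eps _|].
  by split; [exact: size_trial|exact: normN_trial].
(* [eps < 1] ensures [d <= 1], for every [N]. *)
exists 1; split=> // eps eps0 eps1.
have N0 : 0 < n.+2%:R :> R by rewrite ltr0n.
set d := eps ^+ 2 / n.+2%:R.
have d0 : 0 < d by rewrite divr_gt0// exprn_gt0.
have d1 : d <= 1.
  rewrite ler_pdivrMr// mul1r (le_trans (y := 1))//; last by rewrite ler1n.
  by rewrite expr_le1// ltW.
split.
  rewrite (_ : 4^-1 / _ * _ = d / 4); last by rewrite /d; field; rewrite gt_eqF.
  (* A lower bound passes to the infimum of a nonempty set; [a = 0], [t = 0] provide an element. *)
  apply: lb_le_inf.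
    exists (normN n.+2 (trial_family n.+2 d - expi 0 *: kernelN n.+2 0)), 0, 0.
    by split=> //; rewrite lexx mulr_ge0// pi_ge0.
  by move=> _ [a [t [_ ->]]]; exact: trial_distance.
apply: le_trans (wehrl_trial n d) _.
by rewrite le_eqVlt; apply/orP; left; apply/eqP; rewrite /d; field; rewrite gt_eqF.
Qed.
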